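(* For every integer $n\ge 1$, the projection constant of $\mathrm{Lip}_0(\mathbb{Z}_2^n)$, where $\mathbb{Z}_2^n$ is the Hamming cube with its graph (Hamming) distance, is $\lambda(\mathrm{Lip}_0(\mathbb{Z}_2^n))=\dfrac{n+1}{2}$.
   Context: The Hamming cube $\mathbb{Z}_2^n$ is the graph with vertex set $\{0,1\}^n$ in which two vertices are adjacent if and only if they differ in exactly one coordinate; its graph distance is the number of differing coordinates. For a metric space $X$ with a base point $O$ (here e.g. $(0,\dots,0)$), $\mathrm{Lip}_0(X)$ is the space of Lipschitz functions $f:X\to\mathbb{R}$ with $f(O)=0$, normed by the Lipschitz constant. For a finite-dimensional normed space $Y$, the projection constant is $\lambda(Y)=\inf\{\|P\|: P:\ell_\infty\to\ell_\infty\text{ is a linear projection with range }Y_1\}$, where $Y_1$ is any subspace of $\ell_\infty$ isometrically isomorphic to $Y$ (the value does not depend on the choice of $Y_1$). *)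

(* Defs.v *)
From HB Require Import structures.
From mathcomp Require Import all_boot all_order all_algebra.
From mathcomp Require Import all_classical all_reals all_analysis.

Set Implicit Arguments.
Unset Strict Implicit.
Unset Printing Implicit Defensive.

Import Order.TTheory GRing.Theory Num.Theory.
Import numFieldNormedType.Exports.

Local Open Scope classical_set_scope.
Local Open Scope ring_scope.

Section Hamming.
Variable n : nat.
Implicit Types x y z : {ffun 'I_n -> bool}.

Definition hamming x y : nat := #|[pred i | x i != y i]|.

Definition cube_adj x y : bool := hamming x y == 1%N.

Lemma hammingxx x : hamming x x = 0%N.
Proof. by apply: eq_card0 => i; rewrite !inE eqxx. Qed.

Lemma hamming_eq0 x y : hamming x y = 0%N -> x = y.
Proof. by move=> /card0_eq xy; apply/ffunP => i; have /negbFE/eqP := xy i. Qed.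

Lemma hamming_sym x y : hamming x y = hamming y x.
Proof. by apply: eq_card => i; rewrite !inE eq_sym. Qed.

Lemma hamming_triangle y x z : (hamming x z <= hamming x y + hamming y z)%N.
Proof.
rewrite /hamming -[leqRHS]cardUI; apply: leq_trans (leq_addr _ _).
apply: subset_leq_card; apply/fintype.subsetP => i; rewrite !inE.
by case: (x i); case: (y i); case: (z i).
Qed.

(* [hamming] is the graph distance of the graph with adjacency [cube_adj]. *)
Lemma hamming_path x p : path cube_adj x p -> (hamming x (last x p) <= size p)%N.
Proof.
elim: p x => [|y p IHp] x /=; first by rewrite hammingxx.
case/andP => /eqP xy /IHp yp; apply: leq_trans (hamming_triangle y _ _) _.
by rewrite xy add1n ltnS.
Qed.

Lemma hamming_geodesic x y :
  exists p, [/\ path cube_adj x p, last x p = y & size p = hamming x y].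
Proof.
move dE: (hamming x y) => d; elim: d x dE => [|d IHd] x dE.
  by exists [::]; split=> //; apply: hamming_eq0.
have /card_gt0P[i] : (0 < #|[pred i | x i != y i]|)%N by rewrite -/(hamming x y) dE.
rewrite inE => xyi.
pose z := [ffun j => if j == i then y i else x j].
have xz : cube_adj x z.
  rewrite /cube_adj /hamming -(card1 i); apply/eqP/eq_card => j.
  by rewrite !inE ffunE; case: (eqVneq j i) => [->//|_]; rewrite eqxx.
have zy : hamming z y = d.
  move: dE; rewrite /hamming (cardD1 i) inE xyi add1n => -[<-].
  by apply: eq_card => j; rewrite !inE ffunE; case: (eqVneq j i) => [->|//]; rewrite eqxx.
have [p [zp py ps]] := IHd _ zy.
by exists (z :: p); rewrite /= xz ps.
Qed.

End Hamming.

(* The parameter R, unused in the carrier, is the field in which distances are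
   measured: it lets type inference recover R in [metricType R]. *)
Definition cube (R : realType) (n : nat) : Type := {ffun 'I_n -> bool}.

Section CubeMetric.
Variables (R : realType) (n : nat).

HB.instance Definition _ := Choice.copy (cube R n) {ffun 'I_n -> bool}.

Let dist (x y : cube R n) : R := (hamming x y)%:R.

Let distxx x : dist x x = 0. Proof. by rewrite /dist hammingxx. Qed.

Let dist_positivity x y : dist x y = 0 -> x = y.
Proof. by move/eqP; rewrite pnatr_eq0 => /eqP/hamming_eq0. Qed.

Let dist_sym x y : dist x y = dist y x.
Proof. by rewrite /dist hamming_sym. Qed.

Let dist_triangle y x z : dist x z <= dist x y + dist y z.
Proof. by rewrite /dist -natrD ler_nat hamming_triangle. Qed.

HB.instance Definition _ :=
  isMetric.Build R (cube R n) distxx dist_positivity dist_sym dist_triangle.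

End CubeMetric.

Section Lip0.
Variables (R : realType) (X : metricType R) (O : X).

Definition lipschitz_fun (f : X -> R) :=
  exists k : R, forall x y, `|f x - f y| <= k * mdist x y.

Definition lip0 : {pred X -> R} := mem [set f | lipschitz_fun f /\ f O = 0].

Lemma lip0P f : reflect (lipschitz_fun f /\ f O = 0) (f \in lip0).
Proof. by apply: (iffP idP) => [/set_mem//|?]; exact/mem_set. Qed.

Record Lip0 := MkLip0 { lip0_val :> X -> R; _ : lip0_val \in lip0 }.

HB.instance Definition _ := [isSub for lip0_val].
HB.instance Definition _ := [Choice of Lip0 by <:].

Lemma lip0_submod_closed : submod_closed lip0.
Proof.
split=> [|a f g /lip0P[[k kf] f0] /lip0P[[l lg] g0]]; apply/lip0P; split=> //.
- by exists 0 => x y; rewrite subrr normr0 mul0r.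
- exists (`|a| * k + l) => x y.
  rewrite !fctE opprD addrACA -scalerBr mulrDl.
  rewrite (le_trans (ler_normD _ _))// lerD// normrZ -mulrA.
  exact: ler_wpM2l.
- by rewrite !fctE f0 g0 scaler0 addr0.
Qed.

HB.instance Definition _ :=
  GRing.isSubmodClosed.Build R (X -> R) lip0 lip0_submod_closed.
HB.instance Definition _ := [SubChoice_isSubLmodule of Lip0 by <:].

Implicit Types f g : Lip0.

Lemma Lip0DE f g x : (f + g : Lip0) x = f x + g x. Proof. by []. Qed.

Lemma Lip0ZE (a : R) f x : (a *: f : Lip0) x = a * f x. Proof. by []. Qed.

Definition lip_slopes (f : X -> R) : set R :=
  [set `|f p.1 - f p.2| / mdist p.1 p.2 | p in [set p : X * X | p.1 != p.2]].

(* On a one-point space the supremum is [sup set0], which is 0. *)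
Definition lip_const (f : X -> R) : R := sup (lip_slopes f).

Lemma lip_slopes_ubound f : has_ubound (lip_slopes f).
Proof.
case: f => f /= /lip0P[[k kf] _]; exists k => _ [p /= p12 <-].
by rewrite ler_pdivrMr ?mdist_gt0.
Qed.

Lemma lip_const_ge0 f : 0 <= lip_const f.
Proof.
rewrite /lip_const; have [->|/set0P[r fr]] := eqVneq (lip_slopes f) set0.
  by rewrite sup0.
apply: le_trans (ub_le_sup (lip_slopes_ubound f) fr).
by case: fr => p /= p12 <-; rewrite divr_ge0// mdist_ge0.
Qed.

Lemma lip_constP f x y : `|f x - f y| <= lip_const f * mdist x y.
Proof.
have [->|xy] := eqVneq x y; first by rewrite subrr normr0 mdistxx mulr0.
rewrite -ler_pdivrMr ?mdist_gt0//; apply: (ub_le_sup (lip_slopes_ubound f)).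
by exists (x, y).
Qed.

Lemma lip_const_le f k : 0 <= k ->
  (forall x y, `|f x - f y| <= k * mdist x y) -> lip_const f <= k.
Proof.
move=> k0 fk; rewrite /lip_const.
have [->|/set0P f0] := eqVneq (lip_slopes f) set0; first by rewrite sup0.
by apply: ge_sup => // _ [p /= p12 <-]; rewrite ler_pdivrMr ?mdist_gt0.
Qed.

Lemma lip_constD f g : lip_const (f + g : Lip0) <= lip_const f + lip_const g.
Proof.
apply: lip_const_le => [|x y]; first by rewrite addr_ge0 ?lip_const_ge0.
rewrite !Lip0DE opprD addrACA mulrDl (le_trans (ler_normD _ _))//.
by rewrite lerD// lip_constP.
Qed.

Let lip_constZ_le (a : R) f : lip_const (a *: f : Lip0) <= `|a| * lip_const f.
Proof.
apply: lip_const_le => [|x y]; first by rewrite mulr_ge0 ?lip_const_ge0.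
rewrite !Lip0ZE -mulrBr normrM -mulrA.
by apply: ler_wpM2l => //; exact: lip_constP.
Qed.

Lemma lip_constZ (a : R) f : lip_const (a *: f : Lip0) = `|a| * lip_const f.
Proof.
apply/eqP; rewrite eq_le lip_constZ_le andTb.
have [->|a0] := eqVneq a 0; first by rewrite normr0 mul0r lip_const_ge0.
have := lip_constZ_le a^-1 (a *: f : Lip0).
by rewrite scalerA mulVf// scale1r normfV -ler_pdivlMl ?invr_gt0 ?normr_gt0// invrK.
Qed.

Lemma lip_const_eq0 f : lip_const f = 0 -> f = 0.
Proof.
move=> f0; apply/val_inj/funext => x /=.
have := lip_constP f x O; rewrite f0 mul0r normr_le0 subr_eq0 => /eqP ->.
by case: (f) => g /= /lip0P[].
Qed.

HB.instance Definition _ := Lmodule_isNormed.Build R Lip0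
  lip_constD lip_constZ lip_const_eq0.

Lemma Lip0_normE f : `|f| = lip_const f. Proof. by []. Qed.

End Lip0.

Section EllInfty.
Variable R : realType.

Definition bounded_seq : {pred nat -> R} :=
  mem [set u | exists M : R, forall i, `|u i| <= M].

Lemma bounded_seqP u :
  reflect (exists M : R, forall i, `|u i| <= M) (u \in bounded_seq).
Proof. by apply: (iffP idP) => [/set_mem//|?]; exact/mem_set. Qed.

Record ell_infty :=
  MkEllInfty { ell_infty_val :> nat -> R; _ : ell_infty_val \in bounded_seq }.

HB.instance Definition _ := [isSub for ell_infty_val].
HB.instance Definition _ := [Choice of ell_infty by <:].

Lemma bounded_seq_submod_closed : submod_closed bounded_seq.
Proof.
split=> [|a u v /bounded_seqP[M uM] /bounded_seqP[N vN]]; apply/bounded_seqP.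
  by exists 0 => i; rewrite normr0.
exists (`|a| * M + N) => i.
rewrite !fctE (le_trans (ler_normD _ _))// lerD// normrZ.
exact: ler_wpM2l.
Qed.

HB.instance Definition _ :=
  GRing.isSubmodClosed.Build R (nat -> R) bounded_seq bounded_seq_submod_closed.
HB.instance Definition _ := [SubChoice_isSubLmodule of ell_infty by <:].

Implicit Types u v : ell_infty.

Lemma ell_inftyDE u v i : (u + v : ell_infty) i = u i + v i. Proof. by []. Qed.

Lemma ell_inftyZE (a : R) u i : (a *: u : ell_infty) i = a * u i. Proof. by []. Qed.

Definition sup_norm (u : nat -> R) : R := sup (range (fun i => `|u i|)).

Lemma sup_norm_ubound u : has_ubound (range (fun i => `|u i|)).
Proof. by case: u => u /= /bounded_seqP[M uM]; exists M => _ [i _ <-]. Qed.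

Lemma sup_normP u i : `|u i| <= sup_norm u.
Proof. by apply: (ub_le_sup (sup_norm_ubound u)); exists i. Qed.

Lemma sup_norm_le u M : (forall i, `|u i| <= M) -> sup_norm u <= M.
Proof.
move=> uM; apply: ge_sup => [|_ [i _ <-]//].
by exists `|u 0%N|, 0%N.
Qed.

Lemma sup_normD u v : sup_norm (u + v : ell_infty) <= sup_norm u + sup_norm v.
Proof.
apply: sup_norm_le => i; rewrite ell_inftyDE (le_trans (ler_normD _ _))//.
by rewrite lerD// sup_normP.
Qed.

Let sup_normZ_le (a : R) u : sup_norm (a *: u : ell_infty) <= `|a| * sup_norm u.
Proof.
apply: sup_norm_le => i; rewrite ell_inftyZE normrM.
by apply: ler_wpM2l => //; exact: sup_normP.
Qed.

Lemma sup_normZ (a : R) u : sup_norm (a *: u : ell_infty) = `|a| * sup_norm u.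
Proof.
apply/eqP; rewrite eq_le sup_normZ_le andTb.
have [->|a0] := eqVneq a 0.
  by rewrite normr0 mul0r (le_trans _ (sup_normP _ 0%N)).
have := sup_normZ_le a^-1 (a *: u : ell_infty).
by rewrite scalerA mulVf// scale1r normfV -ler_pdivlMl ?invr_gt0 ?normr_gt0// invrK.
Qed.

Lemma sup_norm_eq0 u : sup_norm u = 0 -> u = 0.
Proof.
move=> u0; apply/val_inj/funext => i /=.
by have := sup_normP u i; rewrite u0 normr_le0 => /eqP.
Qed.

HB.instance Definition _ := Lmodule_isNormed.Build R ell_infty
  sup_normD sup_normZ sup_norm_eq0.

Lemma ell_infty_normE u : `|u| = sup_norm u. Proof. by []. Qed.

End EllInfty.

Section ProjectionConstant.
Variable R : realType.

(* Extended-real valued: +oo for an unbounded operator. *)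
Definition opnorm (V W : normedModType R) (f : V -> W) : \bar R :=
  ereal_sup [set `|f x|%:E | x in [set x : V | `|x| <= 1]].

Definition is_projection_onto (V : normedModType R) (V1 : set V)
    (P : {linear V -> V}) :=
  (forall x, P (P x) = P x) /\ range P = V1.

(* Unbounded projections contribute +oo, hence do not affect the infimum. *)
Definition projection_inf (V : normedModType R) (V1 : set V) : \bar R :=
  ereal_inf [set opnorm P | P in [set P : {linear V -> V} | is_projection_onto V1 P]].

Definition isometric_copy (Y V : normedModType R) (V1 : set V) :=
  exists j : {linear Y -> V}, (forall y, `|j y| = `|y|) /\ range j = V1.

(* [is_projection_constant Y c] is "lambda(Y) = c": Y embeds in ell_infty, and
   the infimum is c whichever isometric copy of Y in ell_infty is chosen. *)
Definition is_projection_constant (Y : normedModType R) (c : \bar R) :=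
  (exists Y1 : set (ell_infty R), isometric_copy Y Y1) /\
  (forall Y1 : set (ell_infty R), isometric_copy Y Y1 -> projection_inf Y1 = c).

End ProjectionConstant.

(* Main.v *)
(* A map of norm 1 into ell_infty extends from a subspace (Hahn-Banach, one
   coordinate at a time), so every isometric copy of Y in ell_infty gives the
   same infimum, and it suffices to study the copy of Lip_0 of the cube in the
   functions on arcs (i, x) given by f |-> f (x + e_i) - f x.

   Upper bound: the orthogonal projection onto gradients sends, at each Walsh
   frequency A, a vector (c_i)_(i in A) to the constant vector of its average.
   The row of its matrix at direction j has, at direction i, absolute sum
   equal to the average over z of |sum_(A containing i, j) walsh A z / |A||.
   Multiplied by walsh {i, j} z the inner sum becomes the integral over [0, 1]
   of a product of factors t and 1 +- t, hence is nonnegative, and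
   orthogonality evaluates the average as 1 / |{i, j}|. Summing over i gives
   1 + (n - 1) / 2.

   Lower bound: the signs of that matrix, walsh {i, k} x * walsh {i, k} y, form
   an operator U that preserves gradients, so the trace of Q U is the same for
   all projections Q onto gradients. U is 2^n times the identity at frequencies
   of size 1 and 2 and zero at the others, so this trace is
   2^n (n + n (n - 1) / 2); it is at most n 2^n times the norm of Q. *)
From HB Require Import structures.
Require Import Defs.
From mathcomp Require Import all_boot all_order all_algebra.
From mathcomp Require Import all_classical all_reals all_analysis.
From mathcomp Require Import polyrcf ring lra.

Set Implicit Arguments.
Unset Strict Implicit.
Unset Printing Implicit Defensive.

Import Order.TTheory GRing.Theory Num.Theory.
Import numFieldNormedType.Exports.

Local Open Scope classical_set_scope.
Local Open Scope ring_scope.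

Lemma linear_pack (R : pzRingType) (U V : lmodType R) (f : U -> V) :
  linear f -> exists g : {linear U -> V}, forall x, g x = f x.
Proof.
move=> lf.
pose m := GRing.isLinear.Build R U V *:%R f lf.
pose g : {linear U -> V} := HB.pack f m.
by exists g.
Qed.

(** * The Hahn-Banach theorem *)

Section HahnBanach.
Variables (R : realType) (V : lmodType R) (p : V -> R).
Hypothesis pD : forall x y, p (x + y) <= p x + p y.
Hypothesis pZ : forall a x, 0 <= a -> p (a *: x) = a * p x.

(** Partial functionals are encoded by their graphs, so that chains are joined by plain unions. *)
Definition linear_graph (G : set (V * R)) :=
  forall a u v, G u -> G v -> G (a *: u.1 + v.1, a * u.2 + v.2).

Definition dominated_graph (G : set (V * R)) := forall u, G u -> u.2 <= p u.1.

(** The difference [(0, s - r)] also lies in [G], and homogeneity gives [p 0 = 0], so [s <= r]; then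
    exchange the roles. *)
Lemma dominated_graph_fun G x r s : linear_graph G -> dominated_graph G ->
  G (x, r) -> G (x, s) -> r = s.
Proof.
move=> lG dG Gr Gs.
have H t u : G (x, t) -> G (x, u) -> u <= t.
  move=> Gt Gu; have := dG _ (lG (-1) _ _ Gt Gu); rewrite /= scaleN1r addNr.
  by rewrite -(scale0r 0) pZ// mul0r; lra.
by apply/eqP; rewrite eq_le !H.
Qed.

(** The value at [x0] must lie between all [u.2 - p (u.1 - x0)] and all [p (v.1 + x0) - v.2];
    subadditivity of [p] makes room, and the supremum of the lower bounds serves. *)
Lemma graph_extension G x0 : G !=set0 -> linear_graph G -> dominated_graph G ->
  exists H, [/\ G `<=` H, linear_graph H, dominated_graph H &
    exists r, H (x0, r)].
Proof.
move=> [g0 Gg0] lG dG.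
have G0 : G (0, 0).
  have := lG (-1) _ _ Gg0 Gg0.
  by rewrite scaleN1r mulN1r !addNr.
pose L := [set u.2 - p (u.1 - x0) | u in G].
have Lub v : G v -> ubound L (p (v.1 + x0) - v.2).
  move=> Gv _ [u Gu <-].
  have := dG _ (lG 1 _ _ Gu Gv); rewrite /= scale1r mul1r => h1.
  have := pD (u.1 - x0) (v.1 + x0); rewrite addrACA addNr addr0; lra.
have L0 : L !=set0 by exists (0 - p (0 - x0)), (0, 0).
pose c := sup L.
have cub u : G u -> u.2 - p (u.1 - x0) <= c.
  by move=> Gu; apply: ub_le_sup; [exists (p (0 + x0) - 0); exact: (Lub (0,0))|exists u].
have clb v : G v -> c <= p (v.1 + x0) - v.2.
  by move=> Gv; apply: ge_sup => //; exact: Lub.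
exists [set w | exists u t, [/\ G u, w.1 = u.1 + t *: x0 & w.2 = u.2 + t * c]].
split.
- by move=> u Gu; exists u, 0; rewrite scale0r mul0r !addr0.
- move=> a _ _ [u [t [Gu -> ->]]] [v [s [Gv -> ->]]] /=.
  exists (a *: u.1 + v.1, a * u.2 + v.2), (a * t + s); split=> /=.
  + exact: lG.
  + by rewrite scalerDr scalerA scalerDl addrACA.
  + by ring.
- move=> w [u [t [Gu -> ->]]].
  have Gs a : G (a *: u.1, a * u.2).
    by have := lG a _ _ Gu G0; rewrite !addr0.
  (* Dividing by the absolute value of [t] reduces domination to the bounds on [c]: [clb] for
     [t > 0], [cub] for [t < 0]. *)
  have [t0|t0|->] := ltrgt0P t.
  + have := clb _ (Gs t^-1) => /= h.
    have -> : u.1 + t *: x0 = t *: (t^-1 *: u.1 + x0).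
      by rewrite scalerDr scalerA divff ?gt_eqF// scale1r.
    rewrite (pZ _ (ltW _))//.
    have -> : u.2 + t * c = t * (t^-1 * u.2 + c) by field; rewrite gt_eqF.
    by rewrite ler_pM2l//; lra.
  + have Nt0 : 0 < - t by rewrite oppr_gt0.
    have := cub _ (Gs (- t)^-1) => /= h.
    have -> : u.1 + t *: x0 = (- t) *: ((- t)^-1 *: u.1 - x0).
      by rewrite scalerBr scalerA divff ?gt_eqF// scale1r scaleNr opprK.
    rewrite (pZ _ (ltW _))//.
    have -> : u.2 + t * c = (- t) * ((- t)^-1 * u.2 - c).
      by field; rewrite lt_eqF.
    by rewrite ler_pM2l//; lra.
  + by rewrite scale0r mul0r !addr0; exact: dG.
- by exists c, (0, 0), 1; split=> //=; rewrite ?scale1r ?mul1r add0r.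
Qed.

Lemma hahn_banach (G : set (V * R)) : G !=set0 ->
  linear_graph G -> dominated_graph G ->
  exists f : V -> R, [/\ forall a x y, f (a *: x + y) = a * f x + f y,
    forall x, f x <= p x & forall x r, G (x, r) -> f x = r].
Proof.
move=> G0 lG dG.
(* The second clause admits the empty set, the union of the empty chain. *)
pose good (X : set (V * R)) :=
  [/\ linear_graph X, (X !=set0 -> G `<=` X) & dominated_graph X].
have [|A [[lA GA dA] Amax]] := @Zorn_bigcup _ good.
  move=> F Fgood Ftot; split.
  - move=> a u v [X FX Xu] [Y FY Yv].
    have [XY|YX] := Ftot _ _ FX FY.
    + by exists Y => //; have [lY _ _] := Fgood _ FY; apply: lY => //; exact: XY.
    + by exists X => //; have [lX _ _] := Fgood _ FX; apply: lX => //; exact: YX.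
  - move=> [u [X FX Xu]] v Gv; exists X => //.
    by have [_ GX _] := Fgood _ FX; apply: GX => //; exists u.
  - by move=> u [X FX Xu]; have [_ _ dX] := Fgood _ FX; exact: dX.
(* An empty maximal element would be strictly contained in [G]. *)
have A0 : A !=set0.
  apply/set0P/eqP => A0; apply: (Amax G); last by split=> // _ u.
  rewrite A0; split; first exact: sub0set.
  by case: G0 => g Gg /(_ _ Gg).
have totA x : exists r, A (x, r).
  apply: contrapT => nA.
  have [B [AB lB dB [r Br]]] := graph_extension x A0 lA dA.
  apply: (Amax B); last by split=> // _; exact: subset_trans (GA A0) AB.
  by split=> // BA; apply: nA; exists r; exact: BA.
have [f fA] := choice totA.
exists f; split.
- move=> a x y; apply: (dominated_graph_fun lA dA (fA _)).
  exact: (lA a (x, f x) (y, f y)).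
- by move=> x; exact: dA (x, f x) (fA x).
- by move=> x r /(GA A0); exact: dominated_graph_fun.
Qed.

End HahnBanach.

(** * Injectivity of [ell_infty] and independence of the chosen copy *)

Section Injective.
Variable R : realType.

(** Hahn-Banach with the norm as [p], applied to the pairs [(i y, phi y)]; the upper bound at [- x]
    is the lower bound at [x]. *)
Lemma functional_extension (Y V : normedModType R) (i : {linear Y -> V})
    (phi : Y -> R) :
  (forall a x y, phi (a *: x + y) = a * phi x + phi y) ->
  (forall y, phi y <= `|i y|) ->
  exists f : V -> R, [/\ forall a x y, f (a *: x + y) = a * f x + f y,
    forall y, f (i y) = phi y & forall x, `|f x| <= `|x|].
Proof.
move=> lphi phi_le.
have [|a x a0||||f [lf fle fE]] := @hahn_banach _ V (fun x => `|x|) _ _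
  [set (i y, phi y) | y in setT].
- exact: ler_normD.
- by rewrite normrZ ger0_norm.
- by exists (i 0, phi 0), 0.
- by move=> a _ _ [x _ <-] [y _ <-] /=; exists (a *: x + y); rewrite ?linearP ?lphi.
- by move=> _ [y _ <-]; exact: phi_le.
exists f; split=> // [y|x]; first by apply: fE; exists y.
rewrite ler_norml fle andbT lerNl -[leRHS]normrN.
have f0 : f 0 = 0 by have := lf 1 0 0; rewrite scale1r addr0; lra.
rewrite (_ : - f x = f (- x)) ?fle//.
by have := lf (-1) x 0; rewrite !addr0 scaleN1r f0; lra.
Qed.

Lemma ell_infty_injective (Y V : normedModType R) (i : {linear Y -> V})
    (phi : {linear Y -> ell_infty R}) :
  (forall y, `|phi y| <= `|i y|) ->
  exists T : {linear V -> ell_infty R},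
    (forall y, T (i y) = phi y) /\ (forall x, `|T x| <= `|x|).
Proof.
move=> phi_le.
have /choice[f fP] k : exists f : V -> R,
    [/\ forall a x y, f (a *: x + y) = a * f x + f y,
    forall y, f (i y) = phi y k & forall x, `|f x| <= `|x|].
  apply: functional_extension => [a x y|y]; first by rewrite linearP.
  by apply: le_trans (phi_le y); apply: le_trans (ler_norm _) (sup_normP _ _).
have fb x : (fun k => f k x) \in @bounded_seq R.
  by apply/bounded_seqP; exists `|x| => k; have [_ _] := fP k; exact.
have [|T TE] := @linear_pack _ V (ell_infty R) (fun x => MkEllInfty (fb x)).
  move=> a x y; apply/val_inj/funext => k /=.
  by have [+ _ _] := fP k; exact.
exists T; split=> [y|x]; rewrite TE.
  by apply/val_inj/funext => k /=; have [_ + _] := fP k; exact.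
by apply: sup_norm_le => k /=; have [_ _] := fP k; exact.
Qed.

Lemma opnorm_le (V W : normedModType R) (f : V -> W) (c : R) :
  (forall x, `|x| <= 1 -> `|f x| <= c) -> (opnorm f <= c%:E)%E.
Proof. by move=> fc; apply: ge_ereal_sup => _ [x x1 <-]; rewrite lee_fin fc. Qed.

Lemma le_opnorm (V W : normedModType R) (f : V -> W) x :
  `|x| <= 1 -> (`|f x|%:E <= opnorm f)%E.
Proof. by move=> x1; apply: ereal_sup_ubound; exists x. Qed.

(** With contractions [S] extending [j y |-> i y] and [T] extending [i y |-> j y], each projection
    [Q] onto the range of [j] yields the projection [S \o Q \o T] onto the range of [i], of no
    larger norm. *)
Lemma projection_inf_le (Y : normedModType R)
    (i j : {linear Y -> ell_infty R}) :
  (forall y, `|i y| = `|y|) -> (forall y, `|j y| = `|y|) ->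
  (projection_inf (range i) <= projection_inf (range j))%E.
Proof.
move=> iN jN.
have [|S [Sj Sle]] := @ell_infty_injective _ _ j i; first by move=> y; rewrite iN jN.
have [|T [Ti Tle]] := @ell_infty_injective _ _ i j; first by move=> y; rewrite iN jN.
apply: le_ereal_inf_tmp => _ [Q [QQ Qr] <-].
have Qj y : Q (j y) = j y.
  have : range Q (j y) by rewrite Qr; exists y.
  by case=> v _ <-.
have Qv v : exists y, Q v = j y.
  have : range j (Q v) by rewrite -Qr; exists v.
  by case=> y _ <-; exists y.
pose P : {linear ell_infty R -> ell_infty R} := S \o Q \o T.
apply: (@le_trans _ _ (opnorm P)).
  apply: ereal_inf_lbound; exists P => //; split.
    move=> v /=; have [y ->] := Qv (T v).
    by rewrite Sj Ti Qj Sj.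
  apply/seteqP; split=> [_ [v _ <-]|_ [y _ <-]] /=.
    by have [y ->] := Qv (T v); exists y => //; rewrite Sj.
  by exists (i y) => //=; rewrite Ti Qj Sj.
apply: ge_ereal_sup => _ [v v1 <-].
apply: le_trans (le_opnorm Q (le_trans (Tle v) v1)).
by rewrite lee_fin Sle.
Qed.

Lemma projection_constant_from_copy (Y : normedModType R)
    (i : {linear Y -> ell_infty R}) c :
  (forall y, `|i y| = `|y|) -> projection_inf (range i) = c ->
  is_projection_constant Y c.
Proof.
move=> iN ic; split; first by exists (range i), i.
move=> _ [j [jN <-]]; rewrite -ic.
by apply/eqP; rewrite eq_le !projection_inf_le.
Qed.

End Injective.

(** * Walsh functions on the cube and their harmonic sums *)

Section Walsh.
Variables (R : realType) (n : nat).
Notation vertex := {ffun 'I_n -> bool}.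
Implicit Types (x y z : vertex) (A B D : {set 'I_n}) (i j k : 'I_n).

Definition flip i x : vertex := [ffun k => x k (+) (k == i)].

Lemma flipK i : involutive (flip i).
Proof. by move=> x; apply/ffunP => k; rewrite !ffunE addbK. Qed.

Lemma hamming_flip i x : hamming (flip i x) x = 1%N.
Proof.
rewrite /hamming -(card1 i); apply: eq_card => k; rewrite !inE ffunE.
by case: (x k); case: (k == i).
Qed.

Lemma cube_adj_flip x y : cube_adj x y -> exists i, y = flip i x.
Proof.
move=> /eqP/mem_card1[i xy].
exists i; apply/ffunP => k; have := xy k; rewrite !inE ffunE => <-.
by case: (x k); case: (y k).
Qed.

(** Telescope along a geodesic: a bound on the edges is a Lipschitz bound. *)
Lemma flip_lipschitz (f : vertex -> R) M x y :
  (forall i z, `|f (flip i z) - f z| <= M) ->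
  `|f x - f y| <= M * (hamming x y)%:R.
Proof.
move=> fM; have [p [xp <- <-]] := hamming_geodesic x y.
elim: p x xp => [|z p IHp] x /=; first by rewrite subrr normr0 mulr0.
case/andP => /cube_adj_flip[i ->] /IHp pz.
rewrite -natr1 mulrDr mulr1 [leRHS]addrC.
rewrite (_ : f x - _ =
    (f x - f (flip i x)) + (f (flip i x) - f (last (flip i x) p))).
  by rewrite (le_trans (ler_normD _ _))// lerD// distrC.
by ring.
Qed.

(** The characters of the group Z_2^n. *)
Definition walsh A x : R := \prod_(i in A) (-1) ^+ x i.

Lemma walshM A x y : walsh A x * walsh A y = walsh A [ffun k => x k (+) y k].
Proof.
by rewrite -big_split; apply: eq_bigr => k _; rewrite ffunE signr_addb.
Qed.

Lemma walsh_sqr A x : walsh A x * walsh A x = 1.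
Proof.
by rewrite -big_split big1 //= => k _; rewrite -expr2 sqrr_sign.
Qed.

Lemma normr_walsh A x : `|walsh A x| = 1.
Proof. by rewrite normr_prod big1 // => k _; rewrite normr_sign. Qed.

Lemma walsh_flip A i x :
  walsh A (flip i x) = if i \in A then - walsh A x else walsh A x.
Proof.
case: ifPn => iA.
  rewrite /walsh !(bigD1 i iA) /= -mulNr; congr (_ * _).
    by rewrite ffunE eqxx signr_addb mulrN1.
  by apply: eq_bigr => k /andP[_ ki]; rewrite ffunE (negPf ki) addbF.
apply: eq_bigr => k kA; rewrite ffunE (_ : k == i = false) ?addbF//.
by apply/negP => /eqP ki; rewrite -ki kA in iA.
Qed.

Lemma sum_flip (f : vertex -> R) i : \sum_x f (flip i x) = \sum_x f x.
Proof. by rewrite [RHS](reindex_inj (inv_inj (flipK i))). Qed.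

(** For distinct [A] and [B], flipping a coordinate that lies in just one of them negates every
    term, so the sum is its own opposite. *)
Lemma walsh_orthogonal A B :
  \sum_x walsh A x * walsh B x = if A == B then 2 ^+ n else 0.
Proof.
case: eqVneq => [<-|AB].
  rewrite (eq_bigr (fun=> 1)); last by move=> x _; exact: walsh_sqr.
  by rewrite sumr_const card_ffun card_bool card_ord -natrX.
have [i iAB] : exists i, (i \in A) != (i \in B).
  apply/existsP; apply: contra_neqT AB; rewrite negb_exists => /forallP AB.
  by apply/setP => i; apply/eqP; have := AB i; rewrite negbK.
suff : (\sum_x walsh A x * walsh B x) *+ 2 = 0.
  by move/eqP; rewrite mulrn_eq0 => /eqP.
rewrite mulr2n -{1}(sum_flip _ i) -big_split.
rewrite big1 // => x _ /=; rewrite !walsh_flip.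
by move: iAB; case: (i \in A); case: (i \in B) => // _; ring.
Qed.

(** The sum over [A] is the expansion of a product of factors [1 +- 1], one for each coordinate; a
    coordinate where [x] and [y] differ gives a zero factor. *)
Lemma walsh_complete x y :
  \sum_A walsh A x * walsh A y = if x == y then 2 ^+ n else 0.
Proof.
transitivity (\prod_(k : 'I_n) ((-1) ^+ (x k (+) y k) + 1 : R)).
  rewrite bigA_distr; apply: eq_big => // A _; rewrite -big_split big_mkcond /=.
  by apply: eq_bigr => k _; rewrite signr_addb.
case: eqVneq => [<-|xy].
  rewrite (eq_bigr (fun=> 2)) ?prodr_const ?card_ord// => k _.
  by rewrite addbb.
have [k xyk] : exists k, x k != y k.
  apply/existsP; apply: contra_neqT xy; rewrite negb_exists => /forallP xy.
  by apply/ffunP => k; apply/eqP; have := xy k; rewrite negbK.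
apply/eqP/prodf_eq0; exists k => //.
by move: xyk; case: (x k); case: (y k) => // _; rewrite addNr.
Qed.

Definition fourier (f : vertex -> R) A : R :=
  (2 ^+ n)^-1 * \sum_x f x * walsh A x.

Lemma fourier_inversion f x : \sum_A fourier f A * walsh A x = f x.
Proof.
transitivity ((2 ^+ n)^-1 * \sum_y f y * \sum_A walsh A y * walsh A x).
  under eq_bigr do rewrite -mulrA mulr_suml.
  rewrite -mulr_sumr exchange_big /=; congr (_ * _); apply: eq_bigr => y _.
  by rewrite mulr_sumr; apply: eq_bigr => A _; rewrite mulrA.
rewrite (bigD1 x) //= walsh_complete eqxx big1 ?addr0.
  by rewrite mulrCA mulVf ?mulr1// expf_neq0.
by move=> y /negPf yx; rewrite walsh_complete yx mulr0.
Qed.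

Definition grad (f : vertex -> R) i x : R := f (flip i x) - f x.

Lemma grad_walsh A i x : grad (walsh A) i x = if i \in A then - 2 * walsh A x else 0.
Proof. by rewrite /grad walsh_flip; case: ifP => _; ring. Qed.

(** Summation by parts: the flip moves onto the Walsh function, where it costs a sign. *)
Lemma sum_grad_walsh f A i : i \in A ->
  \sum_x grad f i x * walsh A x = - 2 * \sum_x f x * walsh A x.
Proof.
move=> iA; rewrite /grad.
under eq_bigr do rewrite mulrBl.
rewrite sumrB -(sum_flip (fun x => f (flip i x) * walsh A x) i).
under eq_bigr do rewrite flipK walsh_flip iA mulrN.
by rewrite sumrN; ring.
Qed.

(* The right-hand side is the integral over [0, 1] of [t ^+ #|D|.-1] times the
   product over [k \notin D] of the nonnegative factors [1 +- t]. *)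
Lemma walsh_harmonic_ge0 D x : D != finset.set0 ->
  0 <= walsh D x * \sum_(A : {set 'I_n} | D \subset A) #|A|%:R^-1 * walsh A x.
Proof.
move=> D0.
(* [p] is the antiderivative of this integrand that vanishes at 0, so the mean value theorem on
   [0, 1] can replace the integral. *)
pose p := \sum_(A : {set 'I_n} | D \subset A)
  (walsh D x * (#|A|%:R^-1 * walsh A x)) *: 'X^#|A| : {poly R}.
have A0 (A : {set 'I_n}) : D \subset A -> (0 < #|A|)%N.
  by move=> DA; apply: leq_trans (subset_leq_card DA); rewrite card_gt0.
have p0 : p.[0] = 0.
  rewrite horner_sum big1 // => A /A0 cA.
  by rewrite hornerZ hornerXn expr0n eqn0Ngt cA mulr0.
have p1 : p.[1] =
    walsh D x * \sum_(A : {set 'I_n} | D \subset A) #|A|%:R^-1 * walsh A x.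
  rewrite horner_sum mulr_sumr; apply: eq_bigr => A _.
  by rewrite hornerZ hornerXn expr1n mulr1.
have [c c01] := poly_mvt p (ltr01 : 0 < 1 :> R).
rewrite p0 p1 !subr0 mulr1 => ->.
have {c01} /andP[c0 c1] : 0 < c < 1 by move: c01; rewrite in_itv.
(* The extra factor [c] completes [c ^+ #|D|.-1] to one [c] for each element of [D], which makes the
   derivative a product over all coordinates. *)
rewrite -(pmulr_rge0 _ c0) /p raddf_sum /= horner_sum mulr_sumr.
transitivity (0 <= \prod_(k : 'I_n)
    (if k \in D then c else c * (-1) ^+ x k + 1)); last first.
  apply: prodr_ge0 => k _; case: ifP => _; first exact: ltW.
  by case: (x k); rewrite ?expr1 ?expr0; lra.
congr (_ <= _).
(* Each factor is split into a term for [k \in A] and one for [k \notin A]; the zero for [k \in D]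
   kills the sets [A] that do not contain [D]. *)
have -> : \prod_(k : 'I_n) (if k \in D then c else c * (-1) ^+ x k + 1) =
   \prod_(k : 'I_n) ((if k \in D then (-1) ^+ x k else 1) * (c * (-1) ^+ x k) +
     (if k \in D then 0 else 1)).
  apply: eq_bigr => k _; case: ifP => _; last by rewrite mul1r.
  by rewrite addr0 mulrCA -signr_addb addbb mulr1.
rewrite bigA_distr big_mkcond /=; apply: eq_bigr => A _; case: ifPn => DA; last first.
  have [k kD kA] := fintype.subsetPn DA.
  by rewrite (bigD1 k) //= (negPf kA) kD mul0r.
rewrite derivZ derivXn hornerZ hornerMn hornerXn.
transitivity (walsh D x * (\prod_(k in A) (c * (-1) ^+ x k))).
  rewrite big_split /= prodr_const -/(walsh A x).
  have -> : c ^+ #|A| = c * c ^+ #|A|.-1 by rewrite -exprS prednK ?A0.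
  by rewrite -[_ *+ #|A|]mulr_natr; field; rewrite pnatr_eq0 -lt0n A0.
rewrite /walsh big_mkcond [X in _ * X]big_mkcond -big_split /=.
apply: eq_bigr => k _; have := fintype.subsetP DA k.
by case: (k \in D) => [->//|_]; case: (k \in A); rewrite ?mul1r.
Qed.

(** Translation by [x] leaves one variable [z]. By [walsh_harmonic_ge0] taking the absolute value is
    multiplying by [walsh D z], and orthogonality keeps only [A = D]. *)
Lemma sum_walsh_harmonic D (x : vertex) : D != finset.set0 ->
  \sum_y `|\sum_(A : {set 'I_n} | D \subset A)
      #|A|%:R^-1 * (walsh A x * walsh A y)|
  = 2 ^+ n / #|D|%:R.
Proof.
move=> D0; pose t y : vertex := [ffun k => x k (+) y k].
have tinj : injective t.
  by move=> y z /ffunP yz; apply/ffunP => k; have := yz k; rewrite !ffunE => /addbI.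
under eq_bigr do under eq_bigr do rewrite walshM.
rewrite -(reindex_inj tinj (P := predT) (F := fun z =>
  `|\sum_(A : {set 'I_n} | D \subset A) #|A|%:R^-1 * walsh A z|)) /=.
transitivity (\sum_z
    walsh D z * \sum_(A : {set 'I_n} | D \subset A) #|A|%:R^-1 * walsh A z).
  apply: eq_bigr => z _; rewrite -[RHS]ger0_norm ?walsh_harmonic_ge0//.
  by rewrite normrM normr_walsh mul1r.
under eq_bigr do rewrite mulr_sumr.
rewrite exchange_big (bigD1 D) //= [X in _ + X]big1 ?addr0.
  under eq_bigr do rewrite mulrCA.
  by rewrite -mulr_sumr walsh_orthogonal eqxx mulrC.
move=> A /andP[_ AD]; under eq_bigr do rewrite mulrCA.
by rewrite -mulr_sumr walsh_orthogonal eq_sym (negPf AD) mulr0.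
Qed.

Lemma sum_inv_card_set2 i : \sum_k #|[set i; k]%SET|%:R^-1 = (n%:R + 1) / 2 :> R.
Proof.
rewrite (bigD1 i) //= finset.setUid cards1 invr1.
rewrite (eq_bigr (fun=> 2^-1)); last by move=> k ki; rewrite cards2 eq_sym ki.
rewrite sumr_const cardC1 card_ord -mulr_natr.
have n0 : (0 < n)%N := leq_ltn_trans (leq0n i) (ltn_ord i).
by rewrite -{2}(prednK n0) -natr1; field.
Qed.

End Walsh.

(** * Lipschitz functions on the cube inside [ell_infty], through gradients *)

Section CubeEmbedding.
Variables (R : realType) (n : nat).
Notation vertex := {ffun 'I_n -> bool}.
Implicit Types (x y z : vertex) (A B D : {set 'I_n}) (i j k : 'I_n).
Implicit Types (g h : 'I_n -> vertex -> R).

Definition arc_seq g (m : nat) : R :=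
  if unpickle m is Some a then let: (i, x) := a : 'I_n * vertex in g i x else 0.

Lemma arc_seq_le g M : 0 <= M -> (forall i x, `|g i x| <= M) ->
  forall m, `|arc_seq g m| <= M.
Proof.
by move=> M0 gM m; rewrite /arc_seq; case: unpickle => [[i x]|//]; rewrite ?normr0.
Qed.

Lemma arc_seq_bounded g : arc_seq g \in @bounded_seq R.
Proof.
apply/bounded_seqP; exists (\sum_i \sum_x `|g i x|); apply: arc_seq_le.
  by apply: sumr_ge0 => i _; apply: sumr_ge0.
move=> i x; rewrite (bigD1 i) //= (bigD1 x) //= -addrA lerDl.
by rewrite addr_ge0 ?sumr_ge0 // => k _; rewrite sumr_ge0.
Qed.

Definition arc_vec g : ell_infty R := MkEllInfty (arc_seq_bounded g).

Lemma arc_vecE g i x : arc_vec g (pickle (i, x)) = g i x.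
Proof. by rewrite /= /arc_seq pickleK. Qed.

Lemma ell_infty_ext (u v : ell_infty R) : (forall m, u m = v m) -> u = v.
Proof. by move=> uv; apply/val_inj/funext. Qed.

Lemma ell_infty_sumE (I : finType) (P : pred I) (u : I -> ell_infty R) m :
  (\sum_(s | P s) u s) m = \sum_(s | P s) u s m.
Proof. exact: (big_morph (fun v : ell_infty R => v m)). Qed.

Lemma arc_vec_eq g h : (forall i x, g i x = h i x) -> arc_vec g = arc_vec h.
Proof.
move=> gh; apply: ell_infty_ext => m /=.
by rewrite /arc_seq; case: unpickle => [[i x]|].
Qed.

Lemma arc_vecP a g h :
  arc_vec (fun i x => a * g i x + h i x) = a *: arc_vec g + arc_vec h.
Proof.
apply: ell_infty_ext => m; rewrite ell_inftyDE ell_inftyZE /= /arc_seq.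
by case: unpickle => [[i x]//|]; rewrite mulr0 addr0.
Qed.

Lemma arc_vec_sum (I : finType) (a : I -> R) (G : I -> 'I_n -> vertex -> R) :
  arc_vec (fun i x => \sum_s a s * G s i x) = \sum_s a s *: arc_vec (G s).
Proof.
apply: ell_infty_ext => m; rewrite ell_infty_sumE.
under [RHS]eq_bigr do rewrite ell_inftyZE.
rewrite /= /arc_seq; case: unpickle => [[i x]//|].
by rewrite big1 // => s _; rewrite mulr0.
Qed.

Lemma arc_vec_norm g M : 0 <= M -> (forall i x, `|g i x| <= M) ->
  `|arc_vec g| <= M.
Proof. by move=> M0 gM; apply: sup_norm_le; exact: arc_seq_le. Qed.

(** Subtracting [F o] changes no gradient, so the gradients of arbitrary functions on the cube all
    come from [Lip0 o]. *)
Lemma cube_lip0 (o : cube R n) (F : vertex -> R) :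
  exists f : Lip0 o, forall x, f x = F x - F o.
Proof.
have Flip : (fun x : cube R n => F x - F o) \in lip0 o.
  apply/lip0P; split; last exact: subrr.
  exists (\sum_i \sum_x `|grad F i x|) => x y.
  rewrite opprB addrA subrK; apply: flip_lipschitz => i z.
  rewrite -/(grad F i z) (bigD1 i) //= (bigD1 z) //= -addrA lerDl.
  by rewrite addr_ge0 ?sumr_ge0 // => k _; rewrite sumr_ge0.
by exists (MkLip0 Flip).
Qed.

(** Isometry: each arc joins points at distance 1, and by [flip_lipschitz] the arcs already
    determine the Lipschitz constant. *)
Lemma cube_embedding (o : cube R n) :
  exists e : {linear Lip0 o -> ell_infty R},
    (forall f, `|e f| = `|f|) /\ forall f, e f = arc_vec (grad f).
Proof.
have [|e eE] := @linear_pack _ (Lip0 o) (ell_infty R) (fun f => arc_vec (grad f)).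
  move=> a f g; rewrite -arc_vecP; apply: arc_vec_eq => i x.
  by rewrite /grad !Lip0DE !Lip0ZE; ring.
exists e; split=> // f; rewrite eE; apply/eqP; rewrite eq_le; apply/andP; split.
  apply: arc_vec_norm => [|i x]; first exact: lip_const_ge0.
  apply: le_trans (lip_constP f _ _) _.
  by rewrite [mdist _ _](_ : _ = (hamming (flip i x) x)%:R)// hamming_flip mulr1.
apply: lip_const_le; first exact: normr_ge0.
move=> x y; apply: flip_lipschitz => i z.
by rewrite -/(grad f i z) -(arc_vecE (grad f)); exact: sup_normP.
Qed.

End CubeEmbedding.

(** * Upper bound: the orthogonal projection onto gradients *)

Section CubeProjection.
Variables (R : realType) (n : nat).
Notation vertex := {ffun 'I_n -> bool}.
Implicit Types (x y z : vertex) (A B D : {set 'I_n}) (i j k : 'I_n).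
Implicit Types (v : ell_infty R).

(* The coefficient of [\sum_(i in A) walsh A e_i] in the orthogonal projection
   onto gradients. *)
Definition arc_coef v A : R :=
  #|A|%:R^-1 * \sum_(i in A) (2 ^+ n)^-1 * \sum_x v (pickle (i, x)) * walsh R A x.

Lemma arc_coefP a u v A : arc_coef (a *: u + v) A = a * arc_coef u A + arc_coef v A.
Proof.
rewrite /arc_coef mulrCA -mulrDr; congr (_ * _).
rewrite mulr_sumr -big_split; apply: eq_bigr => i _ /=.
rewrite mulrCA -mulrDr; congr (_ * _).
rewrite mulr_sumr -big_split; apply: eq_bigr => x _ /=.
by rewrite mulrA -mulrDl.
Qed.

(** A gradient has the same Walsh coefficient at [A] in all directions of [A], so averaging returns
    it. *)
Lemma arc_coef_grad (f : vertex -> R) A : A != finset.set0 ->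
  arc_coef (arc_vec (grad f)) A = - 2 * fourier f A.
Proof.
move=> A0; rewrite /arc_coef (eq_bigr (fun=> - 2 * fourier f A)).
  rewrite sumr_const -[(_ * _) *+ _]mulr_natl mulKf//.
  by rewrite pnatr_eq0 -lt0n card_gt0.
move=> i iA; rewrite /fourier mulrCA -(sum_grad_walsh f iA); congr (_ * _).
by apply: eq_bigr => x _; rewrite arc_vecE.
Qed.

Definition arc_proj v j y : R :=
  \sum_(A : {set 'I_n} | j \in A) arc_coef v A * walsh R A y.

(** A primitive of [arc_proj v]: [- 2^-1] cancels the factor [- 2] of [grad_walsh]. *)
Definition potential v x : R := \sum_A (- 2^-1 * arc_coef v A) * walsh R A x.

Lemma grad_sum (a : {set 'I_n} -> R) i x :
  grad (fun y => \sum_A a A * walsh R A y) i x =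
  \sum_(A : {set 'I_n} | i \in A) - 2 * a A * walsh R A x.
Proof.
rewrite /grad -sumrB [RHS]big_mkcond; apply: eq_bigr => A _.
by rewrite walsh_flip; case: ifP => _; ring.
Qed.

Lemma grad_potential v j y : grad (potential v) j y = arc_proj v j y.
Proof. by rewrite grad_sum; apply: eq_bigr => A _; field. Qed.

Lemma arc_proj_grad (f : vertex -> R) j y :
  arc_proj (arc_vec (grad f)) j y = grad f j y.
Proof.
transitivity (grad (fun y => \sum_A fourier f A * walsh R A y) j y); last first.
  by rewrite /grad !fourier_inversion.
rewrite grad_sum; apply: eq_bigr => A jA; rewrite arc_coef_grad//.
by apply/set0Pn; exists j.
Qed.

(** The projection in matrix form: only sets containing both directions link the arcs [(j, y)] and
    [(i, x)]. *)
Lemma arc_projE v j y : arc_proj v j y =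
  \sum_i \sum_x (2 ^+ n)^-1 * v (pickle (i, x)) *
    \sum_(A : {set 'I_n} | [set j; i]%SET \subset A)
      #|A|%:R^-1 * (walsh R A y * walsh R A x).
Proof.
under [RHS]eq_bigr do under eq_bigr do rewrite mulr_sumr.
under [RHS]eq_bigr do rewrite exchange_big /=.
rewrite (exchange_big_dep (fun A => j \in A)) /=; last first.
  by move=> i A _; rewrite finset.subUset !finset.sub1set => /andP[].
apply: eq_bigr => A jA; rewrite /arc_coef mulr_sumr mulr_suml.
apply: eq_big => i; first by rewrite finset.subUset !finset.sub1set jA.
move=> iA; rewrite mulrA mulr_sumr mulr_suml.
by apply: eq_bigr => x _; ring.
Qed.

(** The value is at most the absolute row sum, whose part in direction [i] is evaluated by
    [sum_walsh_harmonic] with [D = [set j; i]]. *)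
Lemma arc_proj_le v j y : `|v| <= 1 -> `|arc_proj v j y| <= (n%:R + 1) / 2.
Proof.
move=> v1; rewrite arc_projE -(sum_inv_card_set2 R j).
apply: le_trans (ler_norm_sum _ _ _) _; apply: ler_sum => i _.
apply: le_trans (ler_norm_sum _ _ _) _.
have D0 : [set j; i]%SET != finset.set0 by apply/set0Pn; exists j; rewrite !inE eqxx.
have n0 : (2 ^+ n : R) != 0 by rewrite expf_neq0.
rewrite -[leRHS](mulKf n0) -(sum_walsh_harmonic R y D0) mulr_sumr.
apply: ler_sum => x _; rewrite !normrM -mulrA.
rewrite [`|_^-1|]ger0_norm ?invr_ge0 ?exprn_ge0//.
rewrite ler_wpM2l ?invr_ge0 ?exprn_ge0//.
by rewrite -[leRHS]mul1r ler_wpM2r// (le_trans (sup_normP _ _)).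
Qed.

Lemma projection_inf_cube_le (o : cube R n) (e : {linear Lip0 o -> ell_infty R}) :
  (forall f, e f = arc_vec (grad f)) ->
  (projection_inf (range e) <= ((n%:R + 1) / 2 : R)%:E)%E.
Proof.
move=> eE.
have [|P PE] := @linear_pack _ (ell_infty R) (ell_infty R)
    (fun v => arc_vec (arc_proj v)).
  move=> a u v; rewrite -arc_vecP; apply: arc_vec_eq => i x.
  rewrite /arc_proj mulr_sumr -big_split; apply: eq_bigr => A _ /=.
  by rewrite arc_coefP mulrDl mulrA.
have Pe f : P (e f) = e f.
  by rewrite PE eE; apply: arc_vec_eq => i x; rewrite arc_proj_grad.
have Pr v : exists f, P v = e f.
  have [f fE] := cube_lip0 o (potential v).
  exists f; rewrite PE eE; apply: arc_vec_eq => i x.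
  by rewrite -grad_potential /grad !fE; ring.
apply: (@le_trans _ _ (opnorm P)); last first.
  apply: opnorm_le => v v1; rewrite PE; apply: arc_vec_norm.
    by rewrite divr_ge0 ?addr_ge0.
  by move=> i x; exact: arc_proj_le.
apply: ereal_inf_lbound; exists P => //; split.
  by move=> v; have [f ->] := Pr v.
apply/seteqP; split=> [_ [v _ <-]|_ [f _ <-]]; last by exists (e f).
by have [f ->] := Pr v; exists f.
Qed.

End CubeProjection.

(** * Lower bound: a trace common to all projections onto gradients *)

Section CubeTrace.
Variables (R : realType) (n : nat).
Notation vertex := {ffun 'I_n -> bool}.
Implicit Types (x y z : vertex) (A B D : {set 'I_n}) (i j k : 'I_n).
Variables (o : cube R n) (e : {linear Lip0 o -> ell_infty R}).
Hypothesis eE : forall f, e f = arc_vec (grad f).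
Variable Q : {linear ell_infty R -> ell_infty R}.
Hypothesis QQ : is_projection_onto (range e) Q.

Definition walsh_arc A j : ell_infty R :=
  arc_vec (fun k x => if k == j then walsh R A x else 0).

Lemma projection_on_grad (f : vertex -> R) : Q (arc_vec (grad f)) = arc_vec (grad f).
Proof.
have [h hE] := cube_lip0 o f.
have -> : arc_vec (grad f) = e h.
  by rewrite eE; apply: arc_vec_eq => i x; rewrite /grad !hE; ring.
have : range Q (e h) by rewrite QQ.2; exists h.
by case=> v _ <-; exact: QQ.1.
Qed.

(** Up to the factor [2 ^+ n], the Walsh coefficient at [A] of the direction-[i] component of
    [Q v]. *)
Definition projection_coef A i (v : ell_infty R) : R :=
  \sum_y walsh R A y * Q v (pickle (i, y)).

(** [Q v] is a gradient, and [sum_grad_walsh] gives a value that does not involve the direction. *)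
Lemma projection_coef_indep A i k v : i \in A -> k \in A ->
  projection_coef A i v = projection_coef A k v.
Proof.
move=> iA kA.
have [f fE] : exists f, Q v = e f.
  have : range e (Q v) by rewrite -QQ.2; exists v.
  by case=> f _ <-; exists f.
have H j : j \in A -> projection_coef A j v = - 2 * \sum_x f x * walsh R A x.
  move=> jA; rewrite -(sum_grad_walsh _ jA); apply: eq_bigr => y _.
  by rewrite fE eE arc_vecE mulrC.
by rewrite !H.
Qed.

(** The sum of [walsh_arc A j] over [j \in A] is a multiple of the gradient of [walsh A], hence
    fixed by [Q]. *)
Lemma projection_coef_sum A i : i \in A ->
  \sum_(j in A) projection_coef A i (walsh_arc A j) = 2 ^+ n.
Proof.
move=> iA; rewrite exchange_big /=.
rewrite (eq_bigr (fun x => walsh R A x * walsh R A x)).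
  by rewrite walsh_orthogonal eqxx.
move=> y _; rewrite -mulr_sumr; congr (_ * _).
transitivity (Q (\sum_(j in A) walsh_arc A j) (pickle (i, y))).
  by rewrite raddf_sum ell_infty_sumE.
have -> : \sum_(j in A) walsh_arc A j = (- 2^-1) *: arc_vec (grad (walsh R A)).
  apply: ell_infty_ext => m; rewrite ell_infty_sumE ell_inftyZE /= /arc_seq.
  case: unpickle => [[k x]|]; last by rewrite big1 ?mulr0.
  rewrite grad_walsh -big_mkcondr /=; case: ifPn => kA; last first.
    rewrite big_pred0 ?mulr0// => j; case: eqVneq => [<-|_]; rewrite ?andbF//.
    by rewrite (negPf kA).
  rewrite (big_pred1 k) => [|j]; first by field.
  by rewrite /= eq_sym; case: eqVneq => [->|_]; rewrite ?andbF ?kA.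
rewrite linearZZ ell_inftyZE projection_on_grad arc_vecE grad_walsh iA.
by field.
Qed.

Lemma projection_trace :
  \sum_i \sum_k projection_coef [set i; k]%SET i (walsh_arc [set i; k]%SET k)
  = 2 ^+ n * n%:R * ((n%:R + 1) / 2).
Proof.
pose a i k := projection_coef [set i; k]%SET i (walsh_arc [set i; k]%SET k).
rewrite -/(\sum_i \sum_k a i k).
(* For [A = [set i; k]] both coefficients may be read in direction [i], so they add up to
   [projection_coef_sum]. On the diagonal [A] is a singleton and [a i i] is counted twice. *)
have aC i k : a i k + a k i = 2 ^+ n + (if i == k then 2 ^+ n else 0).
  case: eqVneq => [<-|ik].
    have := @projection_coef_sum [set i]%SET i; rewrite big_set1 !inE eqxx => /(_ isT).
    by rewrite /a finset.setUid => ->.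
  have iA : i \in [set i; k]%SET by rewrite !inE eqxx.
  have kA : k \in [set i; k]%SET by rewrite !inE eqxx orbT.
  rewrite addr0 -(projection_coef_sum iA) big_setU1 ?inE//= big_set1 addrC.
  by congr (_ + _); rewrite /a finset.setUC (projection_coef_indep _ kA iA).
have : \sum_i \sum_k (a i k + a k i) = 2 * \sum_i \sum_k a i k.
  under eq_bigr do rewrite big_split.
  by rewrite big_split /= [X in _ + X]exchange_big /= mulr_natl.
under eq_bigr do under eq_bigr do rewrite aC.
have aS (i : 'I_n) :
    \sum_k (2 ^+ n + (if i == k then 2 ^+ n else 0)) = 2 ^+ n * (n%:R + 1) :> R.
  rewrite big_split /= -big_mkcond [X in _ + X](big_pred1 i); last first.
    by move=> k; rewrite /= eq_sym.
  by rewrite sumr_const card_ord -[_ *+ n]mulr_natr; ring.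
under eq_bigr do rewrite aS.
rewrite sumr_const card_ord -[_ *+ n]mulr_natr => h; lra.
Qed.

(** The column at the arc [(i, y)] of the symmetric sign operator U. *)
Definition walsh_signs i y : ell_infty R :=
  arc_vec (fun k x => walsh R [set i; k]%SET y * walsh R [set i; k]%SET x).

Lemma walsh_signs_norm i y : `|walsh_signs i y| <= 1.
Proof. by apply: arc_vec_norm => // k x; rewrite normrM !normr_walsh mulr1. Qed.

Lemma walsh_signsE i y :
  walsh_signs i y = \sum_k walsh R [set i; k]%SET y *: walsh_arc [set i; k]%SET k.
Proof.
rewrite -arc_vec_sum; apply: arc_vec_eq => j x.
rewrite (bigD1 j) //= eqxx big1 ?addr0// => k /negPf.
by rewrite eq_sym => ->; rewrite mulr0.
Qed.

(** The left-hand side is the trace of [Q] U; expanding the signs into [walsh_arc] vectors turns it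
    into [projection_trace]. *)
Lemma sum_projection_walsh_signs :
  \sum_i \sum_y Q (walsh_signs i y) (pickle (i, y)) =
  2 ^+ n * n%:R * ((n%:R + 1) / 2).
Proof.
rewrite -projection_trace; apply: eq_bigr => i _.
rewrite [RHS]exchange_big /=.
apply: eq_bigr => y _; rewrite walsh_signsE raddf_sum ell_infty_sumE.
apply: eq_bigr => k _.
exact: (congr1 (fun v : ell_infty R => v (pickle (i, y))) (linearZZ Q _ _)).
Qed.

Lemma opnorm_projection_ge : (1 <= n)%N ->
  (((n%:R + 1) / 2 : R)%:E <= opnorm Q)%E.
Proof.
(* Contradiction also covers an infinite [opnorm Q]: a smaller norm would put each of the n 2^n
   diagonal entries below [(n%:R + 1) / 2], and their sum below the trace. *)
move=> n1; rewrite leNgt; apply/negP => Qlt.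
have H i y : Q (walsh_signs i y) (pickle (i, y)) < (n%:R + 1) / 2.
  rewrite -lte_fin; apply: le_lt_trans Qlt.
  apply: le_trans (le_opnorm Q (walsh_signs_norm i y)).
  by rewrite lee_fin (le_trans (ler_norm _)) // sup_normP.
have /eqP := sum_projection_walsh_signs; apply/negP; rewrite lt_eqF //.
have -> : 2 ^+ n * n%:R * ((n%:R + 1) / 2) =
    \sum_(i : 'I_n) \sum_(y : vertex) (n%:R + 1) / 2 :> R.
  rewrite sumr_const card_ord sumr_const card_ffun card_bool card_ord.
  by rewrite mulrAC mulr_natr -natrX mulr_natl.
(* A strict inequality between the sums requires at least one arc; here [n1] enters. *)
apply: ltr_sum.
  by apply/hasP; exists (Ordinal n1) => //; rewrite mem_index_enum.
move=> i _; apply: ltr_sum => //.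
by apply/hasP; exists [ffun=> false] => //; rewrite mem_index_enum.
Qed.

End CubeTrace.

Theorem theorem63 (R : realType) (n : nat) (hn : (1 <= n)%N) (o : cube R n) :
  is_projection_constant (Lip0 o) (((n%:R + 1) / 2 : R)%:E).
Proof.
have [e [eN eE]] := cube_embedding o.
apply: projection_constant_from_copy eN _.
apply/eqP; rewrite eq_le projection_inf_cube_le//=.
by apply: le_ereal_inf_tmp => _ [Q QQ <-]; exact: opnorm_projection_ge eE _ QQ hn.
Qed.
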